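(* Let $G$ be a finite group such that $(G,Z(G))$ is a Camina pair. Then $|Z(G)| \le |G:G'|$.
   Context: A pair $(G,N)$ is a Camina pair if $N$ is a normal subgroup of the finite group $G$ with $1 < N < G$ (i.e. $N$ is nontrivial and proper) and every element $g \in G \setminus N$ is conjugate in $G$ to every element of the coset $gN$. Here $Z(G)$ is the center of $G$ and $G'=[G,G]$ is the derived subgroup. *)

(* Defs.v *)
From mathcomp Require Import all_boot all_fingroup all_solvable.

Set Implicit Arguments.
Unset Strict Implicit.
Unset Printing Implicit Defensive.

Local Open Scope group_scope.

Definition camina_pair (gT : finGroupType) (G N : {group gT}) : Prop :=
  [/\ N <| G,
      [1 gT] \proper N,
      N \proper G
    & forall g : gT, g \in G :\: N ->
        forall h : gT, h \in g *: N -> exists2 x : gT, x \in G & h = g ^ x].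

(* Main.v *)
(* Let z in Z(G) have prime order p.  An element x of order prime to p lies in
   Z(G), since otherwise x would be conjugate to xz, whose order is p times
   that of x.  Hence G / Z(G) is a p-group and G, being nilpotent, has an
   element g of Z_2(G) outside Z(G).  The class of g contains g Z(G), and by
   the three subgroups lemma the centraliser of g contains G', so
   |Z(G)| <= |G : C_G(g)| <= |G : G'|. *)
Require Import Defs.
From mathcomp Require Import all_boot all_fingroup all_solvable.

Set Implicit Arguments.
Unset Strict Implicit.
Unset Printing Implicit Defensive.

Local Open Scope group_scope.

Lemma camina_pair_sub_class (gT : finGroupType) (G N : {group gT}) (g : gT) :
  camina_pair G N -> g \in G :\: N -> g *: N \subset g ^: G.
Proof.
case=> _ _ _ conjGN gGN; apply/subsetP=> h /(conjGN g gGN) [x xG ->].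
exact: imset_f.
Qed.

Lemma camina_center_p'elt (gT : finGroupType) (G : {group gT}) (p : nat)
    (x : gT) :
  camina_pair G 'Z(G) -> prime p -> p %| #|'Z(G)| -> x \in G -> p^'.-elt x ->
  x \in 'Z(G).
Proof.
move=> camG p_pr /(Cauchy p_pr) [z zZ oz] xG p'x; apply/idPn=> xnZ.
have xGZ : x \in G :\: 'Z(G) by rewrite inE xnZ.
have /imsetP [y _ xzE] : x * z \in x ^: G.
  by apply: (subsetP (camina_pair_sub_class camG xGZ)); rewrite mem_lcoset mulKg.
have cxz : commute x z by exact: (centerC xG zZ).
have co_xz : coprime #[x] #[z].
  by rewrite oz coprime_sym prime_coprime // -p'natE.
have /eqP := congr1 (fun u => #[u]) xzE.
rewrite orderJ orderM // oz -[X in _ == X]muln1 eqn_pmul2l //.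
by rewrite eqn_leq leqNgt prime_gt1.
Qed.

Lemma camina_center_pquotient (gT : finGroupType) (G : {group gT}) (p : nat) :
  camina_pair G 'Z(G) -> prime p -> p %| #|'Z(G)| -> p.-group (G / 'Z(G)).
Proof.
move=> camG p_pr pZ; apply/pgroupP=> q q_pr /(Cauchy q_pr) [u uG ou].
have /morphimP [x xN xG uE] := uG.
apply/idPn=> q'p.
(* The lift [x] of [u] need not be a [q]-element, but its [q]-part also maps to [u]; as [q] differs
   from [p], that part is a [p']-element, hence central, which forces [u = 1]. *)
have xqZ : x.`_q \in 'Z(G).
  apply: (camina_center_p'elt camG p_pr pZ); first by rewrite groupX.
  apply: sub_in_pnat (p_elt_constt q x) => r _; rewrite !inE => /eqP ->.
  by rewrite inE in q'p.
have qu : q.-elt u by rewrite /p_elt ou pnat_id.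
have u1 : u = 1.
  rewrite -(constt_p_elt qu) uE -morph_constt //=; exact: coset_id.
by move: (prime_gt1 q_pr); rewrite -ou u1 order1.
Qed.

Lemma camina_center_nil (gT : finGroupType) (G : {group gT}) :
  camina_pair G 'Z(G) -> nilpotent G.
Proof.
move=> camG; have [_ Z_gt1 _ _] := camG.
rewrite -quotient_center_nil.
(* Any prime divisor of the order of the center would do; one exists because the center is
   nontrivial. *)
apply: (@pgroup_nil _ (pdiv #|'Z(G)|)).
apply: camina_center_pquotient (pdiv_dvd _) => //.
by apply: pdiv_prime; rewrite cardG_gt1 -proper1G.
Qed.

Lemma der1_sub_cent_ucn2 (gT : finGroupType) (G : {group gT}) (g : gT) :
  g \in 'Z_2(G) -> G^`(1) \subset 'C[g].
Proof.
move=> gZ2.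
have ZR : [~: 'Z_2(G), G] \subset 'Z(G) by rewrite -ucn1; exact: ucn_comm.
have ZRR : [~: 'Z_2(G), G, G] = 1.
  by apply/commG1P; apply: subset_trans ZR (subsetIr _ _).
rewrite -cent_set1; apply: (@subset_trans _ _ 'C('Z_2(G))).
  (* The two hypotheses of the three subgroups lemma, [[~: 'Z_2(G), G, G] = 1] and
     [[~: G, 'Z_2(G), G] = 1], agree up to swapping the inner commutator. *)
  by apply/commG1P; rewrite derg1; apply: three_subgroup => //;
    rewrite [X in [~: X, _]]commGC.
by apply: centS; rewrite sub1set.
Qed.

Theorem theorem1 (gT : finGroupType) (G : {group gT}) :
  camina_pair G 'Z(G)%G -> (#|'Z(G)%g| <= #|G : G^`(1)|%g)%N.
Proof.
move=> camG; have [_ _ ZpG _] := camG.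
have /subsetPn [g gZ2 gnZ] : ~~ ('Z_2(G) \subset 'Z(G)).
  (* If the upper central series stopped at the center, [G / 'Z(G)] would be nilpotent with trivial
     center, hence trivial, and [G] would equal its center. *)
  apply: contraL ZpG => /=; rewrite -ucn1 properE ucn_sub /= negbK => sZ2Z.
  rewrite -quotient_sub1 ?ucn_norm // subG1.
  rewrite -(center_nil_eq1 (quotient_nil _ (camina_center_nil camG))).
  by rewrite -ucn_central -subG1 quotient_sub1 //
             (subset_trans (ucn_sub _ _)) ?ucn_norm.
have gG : g \in G := subsetP (ucn_sub 2 G) g gZ2.
have gGZ : g \in G :\: 'Z(G) by rewrite inE gnZ.
rewrite -(card_lcoset 'Z(G) g).
apply: leq_trans (subset_leq_card (camina_pair_sub_class camG gGZ)) _.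
rewrite -index_cent1; apply: dvdn_leq => //; apply: indexgS.
by rewrite subsetI der_sub der1_sub_cent_ucn2.
Qed.
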